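(* For every graph $G$ with $\chi(G)=\omega(G)$ and every integer $d\ge0$, $$\chi(G)=\chi^d(G\boxtimes K_{d+1}).$$ In particular, this equality holds for every perfect graph $G$ and every integer $d\ge 0$.
   Context: Graphs are finite and simple. $\chi$ is the usual chromatic number and $\omega$ is the clique number (maximum size of a set of pairwise adjacent vertices). A colouring of a graph is $d$-improper if each vertex $v$ has at most $d$ neighbours of the same colour as $v$; $\chi^d$ denotes the least number of colours in a $d$-improper colouring. The strong product $G\boxtimes H$ has vertex set $V(G)\times V(H)$, where $(u,u')$ and $(v,v')$ are adjacent if (i) $u=v$ and $u'\sim v'$ in $H$, or (ii) $u'=v'$ and $u\sim v$ in $G$, or (iii) $u\sim v$ in $G$ and $u'\sim v'$ in $H$. $K_{d+1}$ is the complete graph on $d+1$ vertices. *)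

(* Defs.v *)
From mathcomp Require Import all_boot.

Set Implicit Arguments.
Unset Strict Implicit.
Unset Printing Implicit Defensive.

Record sgraph := SGraph {
  vertex :> finType;
  adj : rel vertex;
  adj_sym : symmetric adj;
  adj_irrefl : irreflexive adj
}.

Definition complete_rel (n : nat) : rel 'I_n := fun i j => i != j.

Lemma complete_rel_sym n : symmetric (@complete_rel n).
Proof. by move=> i j; rewrite /complete_rel eq_sym. Qed.

Lemma complete_rel_irrefl n : irreflexive (@complete_rel n).
Proof. by move=> i; rewrite /complete_rel eqxx. Qed.

Definition complete_graph (n : nat) : sgraph :=
  SGraph (@complete_rel_sym n) (@complete_rel_irrefl n).

Definition strong_rel (G H : sgraph) : rel (G * H)%type := fun x y =>
  [|| (x.1 == y.1) && adj x.2 y.2,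
      (x.2 == y.2) && adj x.1 y.1
    | adj x.1 y.1 && adj x.2 y.2].

Lemma strong_rel_sym G H : symmetric (@strong_rel G H).
Proof.
move=> x y; rewrite /strong_rel (eq_sym x.1) (eq_sym x.2).
by rewrite (adj_sym x.1) (adj_sym x.2).
Qed.

Lemma strong_rel_irrefl G H : irreflexive (@strong_rel G H).
Proof. by move=> x; rewrite /strong_rel !adj_irrefl !andbF. Qed.

Definition strong_product (G H : sgraph) : sgraph :=
  SGraph (@strong_rel_sym G H) (@strong_rel_irrefl G H).

Definition induced_rel (G : sgraph) (S : {set G}) : rel {x : G | x \in S} :=
  fun x y => adj (val x) (val y).

Lemma induced_rel_sym G S : symmetric (@induced_rel G S).
Proof. by move=> x y; rewrite /induced_rel adj_sym. Qed.

Lemma induced_rel_irrefl G S : irreflexive (@induced_rel G S).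
Proof. by move=> x; rewrite /induced_rel adj_irrefl. Qed.

Definition induced (G : sgraph) (S : {set G}) : sgraph :=
  SGraph (@induced_rel_sym G S) (@induced_rel_irrefl G S).

Definition clique (G : sgraph) (S : {set G}) : bool :=
  [forall x in S, forall y in S, (x != y) ==> adj x y].

Definition clique_number (G : sgraph) : nat :=
  \max_(S : {set G} | clique S) #|S|.

Definition proper_colouring (G : sgraph) (k : nat) (f : {ffun G -> 'I_k}) : bool :=
  [forall x, forall y, adj x y ==> (f x != f y)].

Definition improper_colouring (G : sgraph) (d k : nat) (f : {ffun G -> 'I_k}) : bool :=
  [forall v, #|[set u | adj v u && (f u == f v)]| <= d].

Definition colourable (G : sgraph) (k : nat) : bool :=
  [exists f : {ffun G -> 'I_k}, proper_colouring f].

Definition improper_colourable (G : sgraph) (d k : nat) : bool :=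
  [exists f : {ffun G -> 'I_k}, improper_colouring d f].

Lemma colourable_exists (G : sgraph) : exists k, colourable G k.
Proof.
exists #|G|; apply/existsP; exists [ffun x => enum_rank x].
apply/forallP=> x; apply/forallP=> y; apply/implyP=> xy.
rewrite !ffunE (inj_eq enum_rank_inj).
by apply: contraTneq xy => ->; rewrite adj_irrefl.
Qed.

Lemma improper_colourable_exists (G : sgraph) (d : nat) :
  exists k, improper_colourable G d k.
Proof.
exists #|G|; apply/existsP; exists [ffun x => enum_rank x].
apply/forallP=> v; rewrite (_ : [set u | _] = set0) ?cards0 //.
apply/setP=> u; rewrite !inE !ffunE (inj_eq enum_rank_inj).
by case: eqVneq => [->|_]; rewrite ?adj_irrefl ?andbF.
Qed.

Definition chromatic_number (G : sgraph) : nat :=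
  ex_minn (colourable_exists G).

Definition improper_chromatic_number (d : nat) (G : sgraph) : nat :=
  ex_minn (improper_colourable_exists G d).

Definition perfect (G : sgraph) : Prop :=
  forall S : {set G},
    chromatic_number (induced S) = clique_number (induced S).

(* Main.v *)
Require Import Defs.
From mathcomp Require Import all_boot.

(** Write [w] for the clique number of [G], [chi] for its chromatic number and
    [chi_d] for the [d]-improper chromatic number of the product of [G] with
    the complete graph on [d.+1] vertices.  When [chi <= w], equality of [chi]
    and [chi_d] follows from the cycle [chi_d <= chi <= w <= chi_d].

    - [chi_d <= chi]: in a proper colouring of [G], blow up each vertex into a
      monochromatic fibre.  A neighbour of the same colour can only lie in the
      same fibre, which has [d] other vertices
      ([colourable_strong_complete]).
    - [w <= chi_d]: a clique of [w] vertices of [G] blows up into a clique of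
      [w * d.+1] vertices ([clique_setX]).  A colour class of a [d]-improper
      colouring meets a clique in at most [d.+1] vertices, so at least [w]
      colours occur ([leq_card_clique_improper]).

    For a perfect graph, [chi <= w] is the case of the induced subgraph on all
    the vertices, which is a copy of [G]: colourings pull back from it along
    the identity, and its cliques are carried to cliques of [G]. *)

Lemma cliqueP (G : sgraph) (S : {set G}) :
  reflect {in S &, forall x y, x != y -> adj x y} (clique S).
Proof.
apply: (iffP forall_inP) => [cS x y xS yS | cS x xS].
  by have /forall_inP/(_ y yS)/implyP := cS x xS.
by apply/forall_inP => y yS; apply/implyP; apply: cS.
Qed.

(** Two vertices of a clique in one colour class are neighbours, so the class
    has at most one vertex plus its [d] neighbours of the same colour; sum over
    the [k] classes. *)
Lemma leq_card_clique_improper (G : sgraph) (d k : nat) (C : {set G}) :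
  clique C -> improper_colourable G d k -> #|C| <= k * d.+1.
Proof.
move=> /cliqueP cC /existsP[f /forallP fd].
rewrite -sum1_card (partition_big f predT) //=.
have <- : \sum_(c < k) d.+1 = k * d.+1 by rewrite sum_nat_const card_ord.
apply: leq_sum => c _; rewrite sum1dep_card.
have [-> | [v]] := set_0Vmem [set x in C | f x == c]; first by rewrite cards0.
rewrite inE => /andP[vC /eqP fv].
apply: leq_trans (_ : #|v |: [set u | adj v u && (f u == f v)]| <= _).
  apply/subset_leq_card/subsetP => u; rewrite !inE => /andP[uC /eqP fu].
  by case: eqVneq => //= u_v; rewrite fu fv eqxx cC // eq_sym.
by rewrite cardsU1 inE adj_irrefl add1n ltnS.
Qed.

Lemma clique_setX (G H : sgraph) (A : {set G}) (B : {set H}) :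
  clique A -> clique B -> clique (setX A B : {set strong_product G H}).
Proof.
move=> /cliqueP cA /cliqueP cB; apply/cliqueP => -[x i] [y j].
rewrite !in_setX => /andP[xA iB] /andP[yA jB]; rewrite xpair_eqE negb_and.
rewrite /= /strong_rel /=.
case: (eqVneq x y) (cA x y xA yA) => [_ _ /= /(cB i j iB jB)-> // | _ -> //] _.
by case: (eqVneq i j) (cB i j iB jB) => [//|_ ->] //; rewrite orbT.
Qed.

Lemma clique_complete (n : nat) : clique [set: complete_graph n].
Proof. by apply/cliqueP. Qed.

Lemma exists_max_clique (G : sgraph) :
  exists2 S : {set G}, clique S & #|S| = clique_number G.
Proof.
have c0 : clique (set0 : {set G}) by apply/cliqueP => x y; rewrite inE.
have n0 : 0 < #|[pred S : {set G} | clique S]|.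
  by apply/card_gt0P; exists set0.
by have [S cS eS] := eq_bigmax_cond (fun S : {set G} => #|S|) n0; exists S.
Qed.

Lemma leq_clique_number_improper (G : sgraph) (d k : nat) :
  improper_colourable (strong_product G (complete_graph d.+1)) d k ->
  clique_number G <= k.
Proof.
move=> fk; have [S cS <-] := exists_max_clique G.
have := leq_card_clique_improper _ _ _ _
  (clique_setX _ _ _ _ cS (clique_complete d.+1)) fk.
by rewrite cardsX cardsT card_ord leq_pmul2r.
Qed.

(** Colour each vertex of the product by its first coordinate: a neighbour of
    [(v, i)] of the same colour is [(v, j)] with [j != i]. *)
Lemma colourable_strong_complete (G : sgraph) (d k : nat) :
  colourable G k ->
  improper_colourable (strong_product G (complete_graph d.+1)) d k.
Proof.
move=> /existsP[f /forallP fP]; apply/existsP.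
exists [ffun x : strong_product G (complete_graph d.+1) => f x.1].
apply/forallP => -[v i].
apply: leq_trans (_ : #|setX [set v] [set~ i]| <= _); last first.
  by rewrite cardsX cards1 cardsC1 card_ord mul1n.
apply/subset_leq_card/subsetP => -[u j].
rewrite !inE !ffunE /= /strong_rel /= => /andP[vu /eqP fuv].
have vu0 : adj v u = false.
  by apply/negP => /(implyP (forallP (fP v) u)); rewrite fuv eqxx.
by move: vu; rewrite vu0 andbF !orbF eq_sym [j == i]eq_sym.
Qed.

Lemma improper_chromatic_number_strong_complete (G : sgraph) (d : nat) :
  chromatic_number G <= clique_number G ->
  chromatic_number G
  = improper_chromatic_number d (strong_product G (complete_graph d.+1)).
Proof.
rewrite /chromatic_number /improper_chromatic_number.
case: ex_minnP => m Gm _ m_w; case: ex_minnP => k Gk k_min.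
apply/eqP; rewrite eqn_leq k_min ?colourable_strong_complete // andbT.
exact/(leq_trans m_w)/(leq_clique_number_improper _ _ _ Gk).
Qed.

Lemma leq_clique_number_induced (G : sgraph) (S : {set G}) :
  clique_number (induced S) <= clique_number G.
Proof.
have [A /cliqueP cA <-] := exists_max_clique (induced S).
rewrite -(card_imset (mem A) val_inj).
apply: (@leq_bigmax_cond _ (@clique G) (fun B => #|B|)); apply/cliqueP.
move=> _ _ /imsetP[x xA ->] /imsetP[y yA ->].
by rewrite (inj_eq val_inj); apply: cA.
Qed.

Lemma leq_chromatic_number_inducedT (G : sgraph) :
  chromatic_number G <= chromatic_number (induced [set: G]).
Proof.
rewrite /chromatic_number; case: ex_minnP => m _ m_min.
case: ex_minnP => k /existsP[f /forallP fP] _; apply: m_min; apply/existsP.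
exists [ffun x => f (exist _ x (in_setT x))].
apply/forallP => x; apply/forallP => y; rewrite !ffunE.
by have /forallP/(_ (exist _ y (in_setT y))) := fP (exist _ x (in_setT x)).
Qed.

Lemma perfect_leq_clique_number (G : sgraph) :
  perfect G -> chromatic_number G <= clique_number G.
Proof.
move=> pG; apply: leq_trans (leq_chromatic_number_inducedT G) _.
by rewrite pG leq_clique_number_induced.
Qed.

Theorem mainTheorem9 :
  (forall (G : sgraph) (d : nat),
     chromatic_number G = clique_number G ->
     chromatic_number G
     = improper_chromatic_number d (strong_product G (complete_graph d.+1)))
  /\
  (forall (G : sgraph) (d : nat),
     perfect G ->
     chromatic_number G
     = improper_chromatic_number d (strong_product G (complete_graph d.+1))).
Proof.
split=> G d hG; apply: improper_chromatic_number_strong_complete.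
  by rewrite hG.
exact: perfect_leq_clique_number.
Qed.
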